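(* Let $\Omega\subset\mathbb{R}^{2}$ be a simply connected domain, let $q$ be a real valued function on $\Omega$, and let $f$ and $g$ be real valued, twice continuously differentiable, nonvanishing solutions in $\Omega$ of the Schrödinger equation $(-\Delta+q)u=0$. Let $z_{0}\in\Omega$, $a\in\mathbb{C}\setminus\{0\}$, $n\in\mathbb{N}=\{1,2,\ldots\}$, and let $Z_{f}^{(-n)}(a,z_{0},z)$ be a formal power of order $-n$, with center at $z_{0}$ and coefficient $a$, associated with the equation $$W_{\overline{z}}=\frac{f_{\overline{z}}}{f}\,\overline{W}.$$ Then the function $$Z_{g}^{(-n)}(a,z_{0},z):=T_{f,g}\left[Z_{f}^{(-n)}(a,z_{0},z)\right]$$ is a formal power of order $-n$, with center at $z_{0}$ and coefficient $a$, associated with the equation $$w_{\overline{z}}=\frac{g_{\overline{z}}}{g}\,\overline{w}.$$ Here $T_{f,g}$ is the transplant operator $$T_{f,g}[W]=P^{+}W+ig^{-1}\overline{A}\left[ig^{2}\partial_{\overline{z}}(g^{-1}P^{+}W)\right],$$ where $$\overline{A}[\Phi](z)=2\int_{\Gamma}\left(\Phi_{1}\,dx+\Phi_{2}\,dy\right),\qquad \Phi=\Phi_1+i\Phi_2,$$ and $\Gamma$ is any rectifiable curve belonging to $\Omega$, leading from $z_{1}$ to $z$ and not passing through $z_{0}$, with $z_1\in\Omega\setminus\{z_0\}$ a fixed initial point.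
   Context: Points $(x,y)\in\mathbb{R}^2$ are identified with complex numbers $z=x+iy$. The subindex $\overline{z}$ denotes application of $\partial_{\overline{z}}:=\frac12(\partial_x+i\partial_y)$. $P^{+}:=\frac12(I+C)$, where $I$ is the identity and $C$ is complex conjugation, so $P^{+}W=\operatorname{Re}W$. In $\overline{A}[\Phi]$, $\Phi_1$ and $\Phi_2$ are the real and imaginary parts of $\Phi$; the operator is applied to functions $\Phi$ satisfying $\partial_y\Phi_1-\partial_x\Phi_2=0$. Solutions of the equation $W_{\overline{z}}=\frac{f_{\overline{z}}}{f}\overline{W}$ are continuously differentiable complex valued functions $W$. Formal power of negative order: for $n\in\mathbb{N}$, $z_0\in\Omega$ and a complex number $a$, a formal power of order $-n$ with center $z_0$ and coefficient $a$ associated with the equation $W_{\overline{z}}=\frac{f_{\overline{z}}}{f}\overline{W}$ is a solution $Z_f^{(-n)}(a,z_0,z)$ of this equation in $\Omega\setminus\{z_0\}$ such that $$\lim_{z\to z_0}\frac{Z_f^{(-n)}(a,z_0,z)}{a(z-z_0)^{-n}}=1.$$ Formal powers associated with $w_{\overline{z}}=\frac{g_{\overline{z}}}{g}\overline{w}$ are defined in the same way with $g$ in place of $f$.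
   Formalization: The integral defining the transplant is assumed not to depend on the curve Γ in Ω∖{z0}; in general it has a nonzero period around z0 (f=1, g=1+x, q=0, z0=0, Z_f=1/z has period −2π), and then T_{f,g}[Z_f] is not a function. *)

(* Defs.v *)
From Stdlib Require Import Reals.
From Coquelicot Require Import Coquelicot.

Open Scope R_scope.

Definition connected_set (D : C -> Prop) : Prop :=
  forall U V : C -> Prop, open U -> open V ->
  (forall z, D z -> U z \/ V z) ->
  (exists z, D z /\ U z) -> (exists z, D z /\ V z) ->
  exists z, D z /\ U z /\ V z.

Definition unit_interval (t : R) : Prop := 0 <= t <= 1.

Definition curve_in (D : C -> Prop) (gam : R -> C) : Prop :=
  continuous_on unit_interval gam /\ forall t, unit_interval t -> D (gam t).

Definition null_homotopic_in (D : C -> Prop) (gam : R -> C) : Prop :=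
  exists H : R * R -> C,
    continuous_on (fun p => unit_interval (fst p) /\ unit_interval (snd p)) H /\
    (forall s t, unit_interval s -> unit_interval t -> D (H (s, t))) /\
    (forall t, unit_interval t -> H (0, t) = gam t /\ H (1, t) = gam 0) /\
    (forall s, unit_interval s -> H (s, 0) = gam 0 /\ H (s, 1) = gam 0).

Definition simply_connected_domain (D : C -> Prop) : Prop :=
  open D /\ (exists z, D z) /\ connected_set D /\
  forall gam : R -> C, curve_in D gam -> gam 0 = gam 1 ->
    null_homotopic_in D gam.

Definition punctured (D : C -> Prop) (z0 z : C) : Prop := D z /\ z <> z0.

Definition Dx (u : C -> R) (z : C) : R := Derive (fun t => u (t, snd z)) (fst z).
Definition Dy (u : C -> R) (z : C) : R := Derive (fun t => u (fst z, t)) (snd z).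

(* [Derive] is total, so the existence of the partial derivatives is required
   explicitly.  [D] is meant to be open. *)
Definition C1_on (D : C -> Prop) (u : C -> R) : Prop :=
  forall z, D z ->
    ex_derive (fun t => u (t, snd z)) (fst z) /\
    ex_derive (fun t => u (fst z, t)) (snd z) /\
    continuous (Dx u) z /\ continuous (Dy u) z.

Definition C2_on (D : C -> Prop) (u : C -> R) : Prop :=
  C1_on D u /\ C1_on D (Dx u) /\ C1_on D (Dy u).

Definition C1c_on (D : C -> Prop) (W : C -> C) : Prop :=
  C1_on D (fun z => Re (W z)) /\ C1_on D (fun z => Im (W z)).

Definition schroedinger_solution (D : C -> Prop) (q u : C -> R) : Prop :=
  forall z, D z -> - (Dx (Dx u) z + Dy (Dy u) z) + q z * u z = 0.

Definition dzbar (W : C -> C) (z : C) : C :=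
  (/ 2 * ((Dx (fun s => Re (W s)) z, Dx (fun s => Im (W s)) z)
          + Ci * (Dy (fun s => Re (W s)) z, Dy (fun s => Im (W s)) z)))%C.

Definition vekua_solution (D : C -> Prop) (f : C -> R) (W : C -> C) : Prop :=
  C1c_on D W /\
  forall z, D z ->
    dzbar W z = (dzbar (fun s => RtoC (f s)) z / f z * Cconj (W z))%C.

Definition formal_power_neg
    (Om : C -> Prop) (f : C -> R) (n : nat) (a z0 : C) (Z : C -> C) : Prop :=
  vekua_solution (punctured Om z0) f Z /\
  filterlim (fun z => Z z / (a * / (z - z0) ^ n))%C (locally' z0) (locally (RtoC 1)).

Definition rectifiable (gam : R -> C) : Prop :=
  exists L : R, forall (n : nat) (t : nat -> R),
    (forall i, (i <= S n)%nat -> unit_interval (t i)) ->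
    (forall i, (i <= n)%nat -> t i <= t (S i)) ->
    sum_f_R0 (fun i => Cmod (gam (t (S i)) - gam (t i))%C) n <= L.

(* The sum of P(gam(y)) (x(s') - x(s)) + Q(gam(y)) (y(s') - y(s)) over the cells
   [s, s'] of a tagged subdivision, with tags y; it has the shape of
   [Riemann_sum], which is the case of an identity integrator. *)
Definition line_sum (P Q : C -> R) (gam : R -> C) (ptd : @SF_seq R) : R :=
  seq.foldr Rplus 0
    (seq.pairmap
       (fun x y =>
          P (gam (snd y)) * (Re (gam (fst y)) - Re (gam (fst x)))
          + Q (gam (snd y)) * (Im (gam (fst y)) - Im (gam (fst x))))
       (SF_h ptd, 0) (SF_t ptd)).

Definition is_line_integral (P Q : C -> R) (gam : R -> C) (I : R) : Prop :=
  filterlim (line_sum P Q gam) (Riemann_fine 0 1) (locally I).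

Definition admissible_curve (Om : C -> Prop) (z0 z1 z : C) (gam : R -> C) : Prop :=
  curve_in (punctured Om z0) gam /\ rectifiable gam /\ gam 0 = z1 /\ gam 1 = z.

(* [A] is the function z |-> 2 int_Gamma (Phi_1 dx + Phi_2 dy), where Gamma may be
   any admissible curve from z1 to z.  It is a relation because the integral
   need not be independent of Gamma when Om is punctured: if the integrals along
   two admissible curves with the same endpoint differ, no [A] qualifies. *)
Definition is_Abar (Om : C -> Prop) (z0 z1 : C) (Phi : C -> C) (A : C -> R) : Prop :=
  forall z gam, admissible_curve Om z0 z1 z gam ->
  exists I : R,
    is_line_integral (fun s => Re (Phi s)) (fun s => Im (Phi s)) gam I /\
    A z = 2 * I.

Definition Pplus (W : C -> C) (z : C) : C := (/ 2 * (W z + Cconj (W z)))%C.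

(* [w] is T_{f,g}[W] on Om \ {z0}; f does not occur in the formula. *)
Definition is_transplant
    (Om : C -> Prop) (z0 z1 : C) (g : C -> R) (W w : C -> C) : Prop :=
  exists A : C -> R,
    is_Abar Om z0 z1
      (fun z => Ci * (g z) ^ 2 * dzbar (fun s => / g s * Pplus W s) z)%C A /\
    forall z, punctured Om z0 z -> w z = (Pplus W z + Ci * / g z * A z)%C.

(* Main.v *)
From Stdlib Require Import Reals Lra Lia Classical.
From Coquelicot Require Import Coquelicot.
Require Import Defs.

(** Write W for the given formal power, U + i V for its real and imaginary
    parts, A for the line-integral function of the transplant, and w for the
    transplant, so that w = U + i A / g.

    Path independence makes A a C1 function.  Prolonging a curve that ends at z
    by a short segment from z to z + h adds to the integral that of the segment,
    which is (Phi_1 dx + Phi_2 dy)(h) + o(|h|); so grad A = 2 (Phi_1, Phi_2)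
    ([Abar_differentiable]).  This applies at every point of the punctured
    domain, because each of them is the end of a rectifiable curve
    ([punctured_reachable]).  With the formula for Phi it reads
    grad A = (g_y U - g U_y, g U_x - g_x U) ([Abar_grad]), which is the Vekua
    equation of g for the pair U, A / g ([transplant_vekua]).

    For the behaviour at z0, compare A with g V.  The Vekua equation of f
    eliminates the derivatives of U and V from the gradient of F = A - g V:
    with alpha + i beta = (g_x - g f_x / f) + i (g_y - g f_y / f),
        F_x = beta U - alpha V,    F_y = - alpha U - beta V
    ([conjugate_difference_grad]).  The functions alpha and beta are bounded near
    z0 and W grows like r^{-n}, with r = |z - z0|, so |grad F| = O(r^{-n}).
    Integration along radii gives F = O(r^{1-n}), or O(log (1/r)) when n = 1; in
    all cases F = o(r^{-n}) ([gradient_growth]).  As w - W = i F / g and g does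
    not vanish at z0, the transplant has the same leading term
    a (z - z0)^{-n} as W. *)

(** * Joining curves *)

Lemma continuous_on_unit_comp : forall (gam : R -> C) (m : R -> R),
  continuous_on unit_interval gam ->
  (forall t, unit_interval t -> unit_interval (m t)) ->
  (forall t, continuous m t) ->
  continuous_on unit_interval (fun t => gam (m t)).
Proof.
intros gam m Hg Hm Hc t Ht.
apply filterlim_comp with (2 := Hg (m t) (Hm t Ht)).
intros P [eps HP].
destruct (proj1 (filterlim_locally m (m t)) (Hc t) eps) as [d Hd].
exists d; intros s Hs Hu.
apply HP; auto.
Qed.

(** The first curve at double speed, then the second.  Clamping the parameters,
    instead of testing on which side of 1/2 the time lies, makes continuity and
    rectifiability immediate from those of the two pieces. *)
Definition join (gam1 gam2 : R -> C) (t : R) : C :=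
  (gam1 (Rmin (2 * t) 1) + (gam2 (Rmax (2 * t - 1) 0) - gam2 0))%C.

Lemma join_left : forall gam1 gam2 t, t <= / 2 -> join gam1 gam2 t = gam1 (2 * t).
Proof.
intros g1 g2 t Ht; unfold join.
rewrite Rmin_left, Rmax_right by lra; ring.
Qed.

Lemma join_right : forall gam1 gam2 t, gam1 1 = gam2 0 -> / 2 <= t ->
  join gam1 gam2 t = gam2 (2 * t - 1).
Proof.
intros g1 g2 t H Ht; unfold join.
rewrite Rmin_right, Rmax_left by lra; rewrite H; ring.
Qed.

Lemma continuous_Rmin1 : forall t, continuous (fun t => Rmin (2 * t) 1) t.
Proof.
intros t; apply continuous_ext with (fun t => (2 * t + 1 - Rabs (2 * t - 1)) / 2).
{ intros x; unfold Rmin, Rabs; destruct Rle_dec, Rcase_abs; lra. }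
apply continuity_pt_filterlim; reg.
Qed.

Lemma continuous_Rmax0 : forall t, continuous (fun t => Rmax (2 * t - 1) 0) t.
Proof.
intros t; apply continuous_ext with (fun t => (2 * t - 1 + Rabs (2 * t - 1)) / 2).
{ intros x; unfold Rmax, Rabs; destruct Rle_dec, Rcase_abs; lra. }
apply continuity_pt_filterlim; reg.
Qed.

Lemma unit_Rmin : forall t, unit_interval t -> unit_interval (Rmin (2 * t) 1).
Proof. intros t []; unfold unit_interval, Rmin; destruct Rle_dec; lra. Qed.

Lemma unit_Rmax : forall t, unit_interval t -> unit_interval (Rmax (2 * t - 1) 0).
Proof. intros t []; unfold unit_interval, Rmax; destruct Rle_dec; lra. Qed.

Lemma curve_in_join : forall D gam1 gam2, gam1 1 = gam2 0 ->
  curve_in D gam1 -> curve_in D gam2 -> curve_in D (join gam1 gam2).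
Proof.
intros D g1 g2 H [C1 I1] [C2 I2]; split.
- assert (K1 := continuous_on_unit_comp _ _ C1 unit_Rmin continuous_Rmin1).
  assert (K2 := continuous_on_unit_comp _ _ C2 unit_Rmax continuous_Rmax0).
  intros t Ht; unfold join.
  refine (filterlim_comp_2 _ _ _ (K1 t Ht) _ (filterlim_plus (V := C_R_NormedModule) _ _)).
  refine (filterlim_comp _ _ _ _ (fun z => z - g2 0)%C _ _ _ (K2 t Ht) _).
  apply (continuous_minus (V := C_R_NormedModule) (fun z : C => z) (fun _ => g2 0)).
  apply continuous_id. apply continuous_const.
- intros t Ht; destruct (Rle_dec t (/ 2)).
  + rewrite join_left by assumption; apply I1; destruct Ht; split; lra.
  + rewrite join_right by (assumption || lra); apply I2; destruct Ht; split; lra.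
Qed.

(** An increment of [join] is the sum of an increment of each curve, and the
    clamped times form a subdivision for each curve. *)
Lemma rectifiable_join : forall gam1 gam2,
  rectifiable gam1 -> rectifiable gam2 -> rectifiable (join gam1 gam2).
Proof.
intros g1 g2 [L1 H1] [L2 H2]; exists (L1 + L2); intros n t Ht Hm.
specialize (H1 n (fun i => Rmin (2 * t i) 1) (fun i Hi => unit_Rmin _ (Ht i Hi))).
specialize (H2 n (fun i => Rmax (2 * t i - 1) 0) (fun i Hi => unit_Rmax _ (Ht i Hi))).
apply Rle_trans with (2 := Rplus_le_compat _ _ _ _
  (H1 (fun i Hi => Rle_min_compat_r _ _ _ (Rmult_le_compat_l 2 _ _ ltac:(lra) (Hm i Hi))))
  (H2 (fun i Hi => Rle_max_compat_r _ _ _ 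
    (Rplus_le_compat_r _ _ _ (Rmult_le_compat_l 2 _ _ ltac:(lra) (Hm i Hi)))))).
rewrite <- plus_sum; apply sum_Rle; intros i Hi; unfold join.
eapply Rle_trans with (2 := Cmod_triangle _ _); right; f_equal; ring.
Qed.

Definition segment (p q : C) (t : R) : C := (p + t * (q - p))%C.

Lemma Re_segment : forall p q t, Re (segment p q t) = Re p + t * (Re q - Re p).
Proof. intros [] [] t; simpl; ring. Qed.

Lemma Im_segment : forall p q t, Im (segment p q t) = Im p + t * (Im q - Im p).
Proof. intros [] [] t; simpl; ring. Qed.

Lemma curve_in_segment : forall (D : C -> Prop) p q,
  (forall t, unit_interval t -> D (segment p q t)) -> curve_in D (segment p q).
Proof.
intros D p q H; split; [|assumption].
intros t _; unfold segment.
apply (filterlim_filter_le_1 _ (filter_le_within (F := locally t) unit_interval)).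
apply (continuous_plus (V := C_R_NormedModule) (fun _ => p) (fun t : R => (t * (q - p))%C)).
apply continuous_const.
apply continuous_ext with (fun t : R => scal (V := C_R_NormedModule) t (q - p)%C).
intros x; apply scal_R_Cmult.
apply (continuous_scal_l (V := C_R_NormedModule)). apply continuous_id.
Qed.

Lemma rectifiable_segment : forall p q, rectifiable (segment p q).
Proof.
intros p q; exists (Cmod (q - p)); intros n t Ht Hm.
assert (E : sum_f_R0 (fun i => Cmod (segment p q (t (S i)) - segment p q (t i))%C) n
  = (t (S n) - t O) * Cmod (q - p)%C).
{ assert (T : forall i, (i <= n)%nat ->
    Cmod (segment p q (t (S i)) - segment p q (t i))%C = (t (S i) - t i) * Cmod (q - p)).
  { intros i Hi.
    replace (segment p q (t (S i)) - segment p q (t i))%C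
      with (RtoC (t (S i) - t i) * (q - p))%C
      by (unfold segment; rewrite RtoC_minus; ring).
    rewrite Cmod_mult, Cmod_R, Rabs_pos_eq; [reflexivity|].
    specialize (Hm i Hi); lra. }
  clear Ht Hm; induction n as [|n IH]; simpl.
  - apply T; lia.
  - rewrite IH, T by (intros; try apply T; lia); ring. }
rewrite E.
destruct (Ht O ltac:(lia)), (Ht (S n) ltac:(lia)).
assert (H3 := Cmod_ge_0 (q - p)%C).
rewrite <- (Rmult_1_l (Cmod (q - p)%C)) at 2; apply Rmult_le_compat_r; lra.
Qed.

(** * Line integrals as limits of sums over uniform subdivisions *)

Definition cell (P Q : C -> R) (gam : R -> C) (s s' : R) : R :=
  P (gam s) * (Re (gam s') - Re (gam s)) + Q (gam s) * (Im (gam s') - Im (gam s)).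

Definition uniform_sum P Q gam (N : nat) : R :=
  sum_f_R0 (fun i => cell P Q gam (INR i / (INR N + 1)) (INR (S i) / (INR N + 1))) N.

Lemma line_sum_left_tags : forall P Q gam (u : nat -> R) N,
  line_sum P Q gam (SF_seq_f2 (fun x _ => x) (seq.mkseq u (S (S N)))) =
  sum_f_R0 (fun i => cell P Q gam (u i) (u (S i))) N.
Proof.
intros P Q gam u N; unfold line_sum; simpl.
set (F := fun x y : R * R => _).
assert (E1 : forall l h c,
  seq.foldr Rplus 0 (seq.pairmap F (h, c) (seq.pairmap (fun x y => (y, x)) h l)) =
  seq.foldr Rplus 0 (seq.pairmap (cell P Q gam) h l)).
{ induction l as [|k l IH]; intros h c; simpl; [reflexivity|].
  rewrite IH; reflexivity. }
change (u 1%nat :: seq.map u (seq.iota 2 N))%list with (seq.map u (seq.iota 1 (S N))).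
transitivity (seq.foldr Rplus 0 (seq.pairmap (cell P Q gam) (u O) (seq.map u (seq.iota 1 (S N))))).
{ apply (E1 (seq.map u (seq.iota 1 (S N))) (u O) 0). }
assert (E2 : forall N m,
  seq.foldr Rplus 0 (seq.pairmap (cell P Q gam) (u m) (seq.map u (seq.iota (S m) (S N)))) =
  sum_f_R0 (fun i => cell P Q gam (u (m + i)%nat) (u (S (m + i)))) N).
{ clear; induction N as [|N IH]; intros m.
  - simpl; rewrite Nat.add_0_r; ring.
  - rewrite (decomp_sum _ (S N)) by lia.
    replace (m + 0)%nat with m by lia.
    specialize (IH (S m)).
    change (seq.foldr Rplus 0 (seq.pairmap (cell P Q gam) (u m) (seq.map u (seq.iota (S m) (S (S N))))))
      with (cell P Q gam (u m) (u (S m)) + seq.foldr Rplus 0 (seq.pairmap (cell P Q gam) (u (S m)) (seq.map u (seq.iota (S (S m)) (S N))))).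
    rewrite IH; f_equal; apply sum_eq; intros i Hi.
    replace (m + S i)%nat with (S m + i)%nat by lia; reflexivity. }
apply E2.
Qed.

(** Integrals over all fine tagged subdivisions are awkward to add; along the
    uniform ones, tagged at the left, concatenation becomes an identity between
    finite sums. *)
Lemma is_line_integral_uniform : forall P Q gam I,
  is_line_integral P Q gam I -> is_lim_seq (uniform_sum P Q gam) I.
Proof.
intros P Q gam I HI.
apply is_lim_seq_ext with
  (fun N => line_sum P Q gam (SF_seq_f2 (fun x _ => x) (unif_part 0 1 N))).
{ intros N; unfold unif_part; rewrite line_sum_left_tags; unfold uniform_sum.
  apply sum_eq; intros i Hi; f_equal; unfold Rdiv; ring. }
apply filterlim_comp with (2 := HI).
intros S [d Hd].
destruct (is_lim_seq_spec (fun N => / (INR N + 1)) 0) as [_ Hl].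
assert (Hinv : is_lim_seq (fun N => / (INR N + 1)) 0).
{ apply is_lim_seq_ext with (fun N => / INR (N + 1)).
  intros N; rewrite plus_INR; reflexivity.
  apply (is_lim_seq_incr_n (fun N => / INR N) 1).
  evar_last. apply is_lim_seq_inv. apply is_lim_seq_INR. discriminate. reflexivity. }
destruct (Hl Hinv d) as [N0 HN].
exists N0; intros N HNN.
destruct (Riemann_fine_unif_part (fun x _ => x) 0 1 N) as (S1 & S2 & S3 & S4);
  [intros; lra | lra |].
apply Hd.
- apply Rle_lt_trans with (1 := S1).
  specialize (HN N HNN); rewrite Rminus_0_r in HN.
  apply Rle_lt_trans with (2 := HN).
  eapply Rle_trans with (2 := Rle_abs _); right; field. 
  assert (H := pos_INR N); lra.
- rewrite Rmin_left, Rmax_right by lra; auto.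
Qed.

(** With an even number of cells, 1/2 is a point of the subdivision. *)
Lemma uniform_sum_join : forall P Q gam1 gam2 N, gam1 1 = gam2 0 ->
  uniform_sum P Q (join gam1 gam2) (2 * N + 1) =
  uniform_sum P Q gam1 N + uniform_sum P Q gam2 N.
Proof.
intros P Q g1 g2 N H; unfold uniform_sum.
rewrite (tech2 _ N) by lia.
replace (2 * N + 1 - S N)%nat with N by lia.
assert (HN := pos_INR N).
replace (INR (2 * N + 1) + 1) with (2 * (INR N + 1))
  by (rewrite plus_INR, mult_INR; simpl; ring).
assert (Hle : forall i, (i <= S N)%nat -> INR i / (2 * (INR N + 1)) <= / 2).
{ intros i Hi; apply le_INR in Hi; rewrite S_INR in Hi.
  apply Rmult_le_reg_r with (2 * (INR N + 1)); [lra|]; field_simplify; lra. }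
assert (Hge : forall i, / 2 <= INR (S N + i) / (2 * (INR N + 1))).
{ intros i; rewrite plus_INR, S_INR.
  assert (Hi := pos_INR i).
  apply Rmult_le_reg_r with (2 * (INR N + 1)); [lra|]; field_simplify; lra. }
f_equal; apply sum_eq; intros i Hi; unfold cell.
- rewrite !join_left by (apply Hle; lia).
  replace (2 * (INR i / (2 * (INR N + 1)))) with (INR i / (INR N + 1)) by (field; lra).
  replace (2 * (INR (S i) / (2 * (INR N + 1)))) with (INR (S i) / (INR N + 1)) by (field; lra).
  reflexivity.
- replace (S (S N + i)) with (S N + S i)%nat by lia.
  rewrite !join_right by (assumption || apply Hge).
  replace (2 * (INR (S N + i) / (2 * (INR N + 1))) - 1) with (INR i / (INR N + 1))
    by (rewrite plus_INR, (S_INR N); field; lra).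
  replace (2 * (INR (S N + S i) / (2 * (INR N + 1))) - 1) with (INR (S i) / (INR N + 1))
    by (rewrite plus_INR, (S_INR N); field; lra).
  reflexivity.
Qed.

(** The estimate that yields differentiability: along a segment on which P and Q
    stay within eps of a and b, all sums are close to their value for constant
    P = a and Q = b, uniformly in the number of cells. *)
Lemma uniform_sum_segment : forall P Q p q a b eps N,
  (forall t, unit_interval t ->
     Rabs (P (segment p q t) - a) <= eps /\ Rabs (Q (segment p q t) - b) <= eps) ->
  Rabs (uniform_sum P Q (segment p q) N - (a * (Re q - Re p) + b * (Im q - Im p)))
  <= eps * (Rabs (Re q - Re p) + Rabs (Im q - Im p)).
Proof.
intros P Q p q a b eps N H; unfold uniform_sum.
assert (HN := pos_INR N).
set (B := eps * _); set (T := a * _ + _).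
assert (Hc : forall i, (i <= N)%nat ->
  Rabs (cell P Q (segment p q) (INR i / (INR N + 1)) (INR (S i) / (INR N + 1))
    - T * / (INR N + 1)) <= B * / (INR N + 1)).
{ intros i Hi.
  assert (Hu : unit_interval (INR i / (INR N + 1))).
  { apply le_INR in Hi; assert (Hi0 := pos_INR i); split.
    - apply Rmult_le_pos; [assumption|]; left; apply Rinv_0_lt_compat; lra.
    - apply Rmult_le_reg_r with (INR N + 1); [lra|]; field_simplify; lra. }
  destruct (H _ Hu) as [H1 H2]; unfold cell.
  set (z := segment p q (INR i / (INR N + 1))) in *.
  replace (Re (segment p q (INR (S i) / (INR N + 1))) - Re z)
    with ((Re q - Re p) * / (INR N + 1))
    by (unfold z; rewrite !Re_segment, S_INR; field; lra).
  replace (Im (segment p q (INR (S i) / (INR N + 1))) - Im z)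
    with ((Im q - Im p) * / (INR N + 1))
    by (unfold z; rewrite !Im_segment, S_INR; field; lra).
  replace (_ - _) with (((P z - a) * (Re q - Re p) + (Q z - b) * (Im q - Im p)) * / (INR N + 1))
    by (unfold T; ring).
  rewrite Rabs_mult, (Rabs_pos_eq (/ _)) by (left; apply Rinv_0_lt_compat; lra).
  apply Rmult_le_compat_r; [left; apply Rinv_0_lt_compat; lra|].
  eapply Rle_trans; [apply Rabs_triang|]; rewrite !Rabs_mult; unfold B.
  rewrite Rmult_plus_distr_l; apply Rplus_le_compat; apply Rmult_le_compat_r; auto using Rabs_pos. }
replace (sum_f_R0 _ N - T) with
  (sum_f_R0 (fun i => cell P Q (segment p q) (INR i / (INR N + 1)) (INR (S i) / (INR N + 1))
    - T * / (INR N + 1)) N).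
2:{ rewrite minus_sum, sum_cte, S_INR; field; lra. }
eapply Rle_trans; [apply Rsum_abs|].
eapply Rle_trans; [apply sum_Rle; intros i Hi; apply Hc; assumption|].
rewrite sum_cte, S_INR; right; field; lra.
Qed.

(** * The line-integral function is differentiable *)

Lemma ball_C_unfold : forall (z w : C) r,
  ball z r w <-> Rabs (Re w - Re z) < r /\ Rabs (Im w - Im z) < r.
Proof. intros z w r; reflexivity. Qed.

Lemma ball_segment : forall (z p q : C) r t, ball z r p -> ball z r q ->
  unit_interval t -> ball z r (segment p q t).
Proof.
assert (K : forall a b c r t : R, Rabs (b - a) < r -> Rabs (c - a) < r -> 0 <= t <= 1 ->
  Rabs (b + t * (c - b) - a) < r).
{ intros a b c r t H1 H2 Ht; apply Rabs_def2 in H1, H2; destruct H1, H2, Ht.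
  destruct (Req_dec t 0) as [->|]; apply Rabs_def1; nra. }
intros z p q r t; rewrite !ball_C_unfold, Re_segment, Im_segment.
intros [] [] Ht; split; apply K; assumption.
Qed.

Lemma admissible_join_segment : forall Om z0 z1 z w gam,
  admissible_curve Om z0 z1 z gam ->
  (forall t, unit_interval t -> punctured Om z0 (segment z w t)) ->
  admissible_curve Om z0 z1 w (join gam (segment z w)).
Proof.
intros Om z0 z1 z w gam (H1 & H2 & H3 & H4) Hs.
assert (E : gam 1 = segment z w 0) by (rewrite H4; unfold segment; ring).
split; [|split; [|split]].
- apply curve_in_join; auto using curve_in_segment.
- apply rectifiable_join; auto using rectifiable_segment.
- rewrite join_left by lra; rewrite Rmult_0_r; assumption.
- rewrite join_right by (assumption || lra); unfold segment.
  replace (2 * 1 - 1) with 1 by ring; ring.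
Qed.

(** The value of A at a nearby point may be computed along gam prolonged by a
    segment, so the increment of A is twice the limit of the sums over the
    segment. *)
Lemma Abar_differentiable : forall Om z0 z1 Phi A z gam,
  open (punctured Om z0) -> is_Abar Om z0 z1 Phi A ->
  admissible_curve Om z0 z1 z gam -> punctured Om z0 z ->
  continuous (fun s => Re (Phi s)) z -> continuous (fun s => Im (Phi s)) z ->
  differentiable_pt_lim (fun x y => A (x, y)) (fst z) (snd z)
    (2 * Re (Phi z)) (2 * Im (Phi z)).
Proof.
intros Om z0 z1 Phi A z gam Ho HA Hg Hz HP HQ eps.
set (P := fun s => Re (Phi s)) in *; set (Q := fun s => Im (Phi s)) in *.
(* The error will be 2 (eps / 4) (|x - Re z| + |y - Im z|), and the sum is at
   most twice the maximum. *)
assert (He : 0 < eps / 4) by (destruct eps; simpl; lra).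
set (e := mkposreal _ He).
assert (L := filter_and _ _ (Ho z Hz)
  (filter_and _ _ (proj1 (filterlim_locally _ _) HP e) (proj1 (filterlim_locally _ _) HQ e))).
destruct L as [r Hr].
exists r; intros x y Hx Hy.
assert (Hw : ball z r ((x, y) : C)) by (split; assumption).
assert (Hs : forall t, unit_interval t -> ball z r (segment z (x, y) t)).
{ intros t Ht; apply ball_segment; auto using ball_center. }
assert (Hj := admissible_join_segment _ _ _ _ (x, y) _ Hg (fun t Ht => proj1 (Hr _ (Hs t Ht)))).
destruct (HA _ _ Hg) as (I & HI & EI); destruct (HA _ _ Hj) as (J & HJ & EJ).
fold P Q in HI, HJ.
replace (fst z, snd z) with z by (destruct z; reflexivity).
rewrite EI, EJ; fold (P z) (Q z).
change (Re (Phi z)) with (P z); change (Im (Phi z)) with (Q z).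
apply is_line_integral_uniform in HI, HJ.
apply is_lim_seq_subseq with (phi := fun N => (2 * N + 1)%nat) in HJ.
2: apply eventually_subseq; intros n; lia.
assert (HD : is_lim_seq (uniform_sum P Q (segment z (x, y))) (J - I)).
{ apply is_lim_seq_ext with (2 := is_lim_seq_minus' _ _ _ _ HJ HI).
  intros N; rewrite uniform_sum_join; [ring|].
  destruct Hg as (_ & _ & _ & ->); unfold segment; ring. }
assert (Hb : Rabs (J - I - (P z * (x - Re z) + Q z * (y - Im z)))
   <= e * (Rabs (x - Re z) + Rabs (y - Im z))).
{ assert (HD' := is_lim_seq_abs _ _ (is_lim_seq_minus' _ _ _ _ HD
    (is_lim_seq_const (P z * (x - Re z) + Q z * (y - Im z))))).
  refine (is_lim_seq_le _ _ _ _ _ HD' (is_lim_seq_const _)).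
  intros N; apply (uniform_sum_segment P Q z (x, y)).
  intros t Ht; destruct (Hr _ (Hs t Ht)) as (_ & B1 & B2).
  split; left; assumption. }
replace (_ - _ - _) with (2 * (J - I - (P z * (x - Re z) + Q z * (y - Im z))))
  by (unfold Re, Im; ring).
rewrite Rabs_mult, (Rabs_pos_eq 2) by lra.
assert (M1 := Rmax_l (Rabs (x - fst z)) (Rabs (y - snd z))).
assert (M2 := Rmax_r (Rabs (x - fst z)) (Rabs (y - snd z))).
unfold Re, Im in *; simpl in Hb; destruct eps as [eps Heps]; simpl in *.
nra.
Qed.

(** * Curves avoiding a point of the domain *)

Definition reachable Om z0 z1 z := exists gam, admissible_curve Om z0 z1 z gam.

Lemma sum_squares_pos : forall a b p1 p2, (p1, p2) <> (a, b) :> C ->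
  0 < (p1 - a) ^ 2 + (p2 - b) ^ 2.
Proof.
intros a b p1 p2 H.
destruct (Req_dec p1 a) as [->|H1].
- destruct (Req_dec p2 b) as [->|H2]; [now elim H|].
  assert (K := pow2_gt_0 (p2 - b) ltac:(lra)); assert (K2 := pow2_ge_0 (a - a)); lra.
- assert (K := pow2_gt_0 (p1 - a) ltac:(lra)); assert (K2 := pow2_ge_0 (p2 - b)); lra.
Qed.

(** If the origin lies on the segment from (x, y) to (u, v), the two vectors are
    parallel.  Then (- y, x), which is (x, y) turned by a right angle, is
    perpendicular to (u, v), and a segment between perpendicular nonzero vectors
    does not meet the origin. *)
Lemma rotation_avoids_line : forall x y u v s t : R,
  0 < x ^ 2 + y ^ 2 -> 0 < u ^ 2 + v ^ 2 ->
  (1 - t) * x + t * u = 0 -> (1 - t) * y + t * v = 0 ->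
  - (1 - s) * y + s * u = 0 -> (1 - s) * x + s * v = 0 -> False.
Proof.
intros x y u v s t Np Nq G1 G2 F1 F2.
assert (Ht : t <> 0).
{ intros ->; replace x with 0 in Np by lra; replace y with 0 in Np by lra; lra. }
assert (K : u * y - v * x = 0).
{ apply Rmult_eq_reg_l with t; [|assumption].
  replace (t * (u * y - v * x)) with ((t * u) * y - (t * v) * x) by ring.
  replace (t * u) with (- (1 - t) * x) by lra.
  replace (t * v) with (- (1 - t) * y) by lra.
  ring. }
assert (Ks : s * (u ^ 2 + v ^ 2) = 0).
{ replace (s * (u ^ 2 + v ^ 2)) with ((s * u) * u + (s * v) * v) by ring.
  replace (s * u) with ((1 - s) * y) by lra.
  replace (s * v) with (- (1 - s) * x) by lra.
  replace (_ + _) with ((1 - s) * (u * y - v * x)) by ring.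
  rewrite K; ring. }
apply Rmult_integral in Ks; destruct Ks as [->|]; [|lra].
replace x with 0 in Np by lra; replace y with 0 in Np by lra; lra.
Qed.

(** A ball is a square here.  When the segment from p to q meets z0, the detour
    goes through p turned by a right angle about z0; the square centred at z0 is
    invariant under that rotation.  A square around another centre is required
    to avoid z0, and then its convexity suffices. *)
Lemma punctured_box_connected : forall Om z0 z1 z r p q,
  (forall w : C, ball z r w -> Om w) ->
  (z <> z0 -> ~ ball z r z0) ->
  ball z r p -> ball z r q -> p <> z0 -> q <> z0 ->
  reachable Om z0 z1 p -> reachable Om z0 z1 q.
Proof.
intros Om z0 z1 z r p q HOm Hz Hp Hq Hp0 Hq0 Hrp.
assert (step : forall p q, ball z r p -> ball z r q ->
  (forall t, unit_interval t -> segment p q t <> z0) ->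
  reachable Om z0 z1 p -> reachable Om z0 z1 q).
{ clear - HOm; intros p q Hp Hq Hs [gam Hg].
  exists (join gam (segment p q)); apply admissible_join_segment; [assumption|].
  intros t Ht; split; auto.
  apply HOm, ball_segment; assumption. }
destruct (classic (forall t, unit_interval t -> segment p q t <> z0)) as [|Hn].
{ apply step with p; assumption. }
apply not_all_ex_not in Hn; destruct Hn as [t Ht].
apply imply_to_and in Ht; destruct Ht as [Ht Es]; apply NNPP in Es.
assert (z = z0); [|subst z].
{ apply NNPP; intros Hne; apply (Hz Hne); rewrite <- Es; apply ball_segment; assumption. }
destruct z0 as [a b], p as [p1 p2], q as [q1 q2].
destruct (proj1 (ball_C_unfold _ _ _) Hp) as [Hp1 Hp2]; simpl in Hp1, Hp2.
assert (E1 : p1 + t * (q1 - p1) = a) by (rewrite <- (Re_segment (p1, p2) (q1, q2)), Es; reflexivity).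
assert (E2 : p2 + t * (q2 - p2) = b) by (rewrite <- (Im_segment (p1, p2) (q1, q2)), Es; reflexivity).
assert (Np : 0 < (p1 - a) ^ 2 + (p2 - b) ^ 2) by now apply sum_squares_pos.
assert (Nq : 0 < (q1 - a) ^ 2 + (q2 - b) ^ 2) by now apply sum_squares_pos.
set (m := (a - (p2 - b), b + (p1 - a))).
assert (Hm : ball ((a, b) : C) r m).
{ apply ball_C_unfold; simpl; split.
  - replace (a - (p2 - b) - a) with (- (p2 - b)) by ring; rewrite Rabs_Ropp; assumption.
  - replace (b + (p1 - a) - b) with (p1 - a) by ring; assumption. }
apply step with m; try assumption; [|apply step with (p1, p2); try assumption].
- intros s [Hs0 Hs1] F.
  assert (F1 := f_equal Re F); assert (F2 := f_equal Im F).
  rewrite Re_segment in F1; rewrite Im_segment in F2; unfold m in F1, F2; simpl in F1, F2.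
  apply (rotation_avoids_line (p1 - a) (p2 - b) (q1 - a) (q2 - b) s t); lra.
- intros s [Hs0 Hs1] F.
  assert (F1 := f_equal Re F); assert (F2 := f_equal Im F).
  rewrite Re_segment in F1; rewrite Im_segment in F2; unfold m in F1, F2; simpl in F1, F2.
  assert (F1' : (1 - s) * (p1 - a) - s * (p2 - b) = 0) by lra.
  assert (F2' : (1 - s) * (p2 - b) + s * (p1 - a) = 0) by lra.
  assert (((1 - s) ^ 2 + s ^ 2) * ((p1 - a) ^ 2 + (p2 - b) ^ 2) = 0).
  { transitivity (((1 - s) * (p1 - a) - s * (p2 - b)) ^ 2
      + ((1 - s) * (p2 - b) + s * (p1 - a)) ^ 2); [ring|].
    rewrite F1', F2'; ring. }
  apply Rmult_integral in H; destruct H; [|lra].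
  assert (K := pow2_ge_0 (s - / 2)); simpl in K, H; lra.
Qed.

Lemma locally_neq : forall z z0 : C, z <> z0 -> locally z (fun w => w <> z0).
Proof.
intros z z0 Hz.
assert (Hd : 0 < Rmax (Rabs (Re z0 - Re z)) (Rabs (Im z0 - Im z))).
{ destruct (Req_dec (Re z0) (Re z)) as [E1|E1].
  destruct (Req_dec (Im z0) (Im z)) as [E2|E2].
  - elim Hz; destruct z, z0; simpl in *; congruence.
  - eapply Rlt_le_trans with (2 := Rmax_r _ _); apply Rabs_pos_lt; lra.
  - eapply Rlt_le_trans with (2 := Rmax_l _ _); apply Rabs_pos_lt; lra. }
exists (mkposreal _ Hd); intros w Hw ->.
destruct (proj1 (ball_C_unfold _ _ _) Hw) as [H1 H2].
simpl in H1, H2; revert H1 H2; apply Rmax_case; intros; lra.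
Qed.

Lemma open_punctured : forall (Om : C -> Prop) z0, open Om -> open (punctured Om z0).
Proof.
intros Om z0 HO z [H1 H2]; apply filter_and; [apply HO, H1 | apply locally_neq, H2].
Qed.

Lemma ball_neq : forall (z z0 : C) (r : posreal), exists w, ball z r w /\ w <> z0.
Proof.
intros z z0 r.
destruct (classic (z = z0)) as [<-|H]; [|exists z; split; [apply ball_center | assumption]].
exists (Re z + r / 2, Im z); assert (Hr := cond_pos r); split.
- apply ball_C_unfold; simpl; split; apply Rabs_def1; lra.
- intros E; apply (f_equal Re) in E; simpl in E; lra.
Qed.

(** Every point of the domain, z0 included, has a punctured neighbourhood of
    which all or no points are reachable.  Both alternatives are open
    conditions, so connectedness leaves only the one that holds at z1. *)
Lemma punctured_reachable : forall Om z0 z1 z,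
  open Om -> connected_set Om -> punctured Om z0 z1 -> punctured Om z0 z ->
  reachable Om z0 z1 z.
Proof.
intros Om z0 z1 z HO HC Hz1 Hz.
set (U := fun z => locally z (fun w : C => w <> z0 -> reachable Om z0 z1 w)).
set (V := fun z => locally z (fun w : C => w <> z0 -> ~ reachable Om z0 z1 w)).
assert (R1 : reachable Om z0 z1 z1).
{ exists (segment z1 z1).
  assert (E : forall t, segment z1 z1 t = z1) by (intros; unfold segment; ring).
  split; [|split; [apply rectifiable_segment | split; apply E]].
  apply curve_in_segment; intros; rewrite E; assumption. }
assert (UV : forall z, Om z -> U z \/ V z).
{ clear z Hz; intros z Hz.
  assert (Hr : exists r : posreal, (forall w : C, ball z r w -> Om w) /\
    (z <> z0 -> ~ ball z r z0)).
  { destruct (classic (z = z0)) as [E|E].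
    - destruct (HO z Hz) as [r Hr]; exists r; split; [assumption | contradiction].
    - destruct (filter_and _ _ (HO z Hz) (locally_neq _ _ E)) as [r Hr].
      exists r; split; [intros w Hw; now apply Hr|].
      intros _ Hb; now apply (proj2 (Hr _ Hb)). }
  destruct Hr as (r & HrO & Hr0).
  destruct (classic (exists p, ball z r p /\ p <> z0 /\ reachable Om z0 z1 p))
    as [(p & Hp & Hp0 & Rp)|Hn].
  - left; exists r; intros q Hq Hq0.
    apply punctured_box_connected with z r p; assumption.
  - right; exists r; intros q Hq Hq0 Rq; apply Hn; exists q; auto. }
assert (disj : forall z, U z -> V z -> False).
{ intros w HU HV; destruct (filter_and _ _ HU HV) as [r Hr].
  destruct (ball_neq w z0 r) as (p & Hp & Hp0).
  destruct (Hr p Hp) as [H1 H2]; exact (H2 Hp0 (H1 Hp0)). }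
destruct (UV z (proj1 Hz)) as [HU|HV].
- apply (locally_singleton _ _ HU), Hz.
- destruct (UV z1 (proj1 Hz1)) as [HU1|HV1].
  + destruct (HC U V) as (w & _ & HU & HV').
    * intros w; apply locally_locally.
    * intros w; apply locally_locally.
    * assumption.
    * exists z1; split; [apply Hz1 | assumption].
    * exists z; split; [apply Hz | assumption].
    * destruct (disj w HU HV').
  + destruct (locally_singleton _ _ HV1 (proj2 Hz1) R1).
Qed.

(** * Functions with continuous partial derivatives *)

(** Names the partial derivatives, so that they can be given by formulas instead
    of as [Dx u] and [Dy u]. *)
Definition C1_grad (D : C -> Prop) (u P Q : C -> R) : Prop :=
  forall z, D z ->
    is_derive (fun t => u (t, snd z)) (fst z) (P z) /\
    is_derive (fun t => u (fst z, t)) (snd z) (Q z) /\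
    continuous P z /\ continuous Q z.

Lemma C1_on_grad : forall D u, C1_on D u -> C1_grad D u (Dx u) (Dy u).
Proof.
intros D u H z Hz; destruct (H z Hz) as (H1 & H2 & H3 & H4).
repeat split; try assumption; apply Derive_correct; assumption.
Qed.

Lemma grad_unique : forall D u P Q z, C1_grad D u P Q -> D z ->
  Dx u z = P z /\ Dy u z = Q z.
Proof.
intros D u P Q z H Hz; destruct (H z Hz) as (H1 & H2 & _).
split; apply is_derive_unique; assumption.
Qed.

Lemma grad_C1_on : forall D u P Q, open D -> C1_grad D u P Q -> C1_on D u.
Proof.
intros D u P Q HD H z Hz; destruct (H z Hz) as (H1 & H2 & H3 & H4).
split; [eexists; apply H1 | split; [eexists; apply H2|split]].
- apply continuous_ext_loc with (2 := H3).
  apply filter_imp with (2 := HD z Hz); intros w Hw.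
  symmetry; apply (grad_unique D u P Q w H Hw).
- apply continuous_ext_loc with (2 := H4).
  apply filter_imp with (2 := HD z Hz); intros w Hw.
  symmetry; apply (grad_unique D u P Q w H Hw).
Qed.

Lemma grad_differentiable : forall D u P Q z, open D -> C1_grad D u P Q -> D z ->
  differentiable_pt_lim (fun x y => u (x, y)) (fst z) (snd z) (P z) (Q z).
Proof.
intros D u P Q z HD H Hz.
apply filterdiff_differentiable_pt_lim.
destruct (H z Hz) as (H1 & H2 & H3 & H4).
destruct z as [x y]; simpl fst in *; simpl snd in *.
refine (is_derive_filterdiff (fun x y => u (x, y)) x y (fun x y => P (x, y)) (Q (x, y)) _ H2 _).
- apply filter_imp with (2 := HD _ Hz); intros [a b] Hw; apply (H _ Hw).
- apply continuous_ext with (2 := H3); intros []; reflexivity.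
Qed.

Lemma differentiable_continuous : forall (u : C -> R) (z : C) lx ly,
  differentiable_pt_lim (fun x y => u (x, y)) (fst z) (snd z) lx ly -> continuous u z.
Proof.
intros u z lx ly H.
assert (K : continuity_2d_pt (fun x y => u (x, y)) (fst z) (snd z))
  by (apply differentiable_continuity_pt; exists lx, ly; assumption).
apply continuity_2d_pt_filterlim in K; destruct z as [x y].
apply filterlim_ext with (2 := K); intros []; reflexivity.
Qed.

Lemma grad_continuous : forall D u P Q z, open D -> C1_grad D u P Q -> D z -> continuous u z.
Proof.
intros D u P Q z HD H Hz.
apply differentiable_continuous with (P z) (Q z).
apply grad_differentiable with D; assumption.
Qed.

Lemma locally_slice : forall (S : C -> Prop) (z : C), locally z S ->
  locally (fst z) (fun t => S (t, snd z)) /\ locally (snd z) (fun t => S (fst z, t)).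
Proof.
intros S [x y] [r Hr]; split; exists r; intros t Ht; apply Hr; split; simpl;
  auto using ball_center.
Qed.

(** Passes between a function given by a formula on D only and one to which the
    rules below apply. *)
Lemma grad_ext : forall (D : C -> Prop) u v P Q P' Q', open D ->
  (forall z, D z -> u z = v z /\ P z = P' z /\ Q z = Q' z) ->
  C1_grad D u P Q -> C1_grad D v P' Q'.
Proof.
intros D u v P Q P' Q' HD E H z Hz; destruct (H z Hz) as (H1 & H2 & H3 & H4).
destruct (locally_slice _ _ (HD z Hz)) as [L1 L2].
destruct (E z Hz) as (_ & <- & <-).
split; [|split; [|split]].
- apply is_derive_ext_loc with (2 := H1).
  apply filter_imp with (2 := L1); intros t Ht; apply (E _ Ht).
- apply is_derive_ext_loc with (2 := H2).
  apply filter_imp with (2 := L2); intros t Ht; apply (E _ Ht).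
- apply continuous_ext_loc with (2 := H3).
  apply filter_imp with (2 := HD z Hz); intros w Hw; apply (E _ Hw).
- apply continuous_ext_loc with (2 := H4).
  apply filter_imp with (2 := HD z Hz); intros w Hw; apply (E _ Hw).
Qed.

Lemma grad_minus : forall D u v P Q P' Q',
  C1_grad D u P Q -> C1_grad D v P' Q' ->
  C1_grad D (fun z => u z - v z) (fun z => P z - P' z) (fun z => Q z - Q' z).
Proof.
intros D u v P Q P' Q' Hu Hv z Hz.
destruct (Hu z Hz) as (H1 & H2 & H3 & H4).
destruct (Hv z Hz) as (K1 & K2 & K3 & K4).
split; [|split; [|split]].
- apply (is_derive_minus (V := R_NormedModule) _ _ _ _ _ H1 K1).
- apply (is_derive_minus (V := R_NormedModule) _ _ _ _ _ H2 K2).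
- apply (continuous_minus (V := R_NormedModule) _ _ _ H3 K3).
- apply (continuous_minus (V := R_NormedModule) _ _ _ H4 K4).
Qed.

Lemma continuous_Rmult : forall (u v : C -> R) z, continuous u z -> continuous v z ->
  continuous (fun s => u s * v s) z.
Proof. intros u v z; apply (continuous_mult (K := R_AbsRing)). Qed.

Lemma continuous_Rplus : forall (u v : C -> R) z, continuous u z -> continuous v z ->
  continuous (fun s => u s + v s) z.
Proof. intros u v z; apply (continuous_plus (V := R_NormedModule)). Qed.

Lemma continuous_Rminus : forall (u v : C -> R) z, continuous u z -> continuous v z ->
  continuous (fun s => u s - v s) z.
Proof. intros u v z; apply (continuous_minus (V := R_NormedModule)). Qed.

Lemma grad_mult : forall D u v P Q P' Q', open D ->
  C1_grad D u P Q -> C1_grad D v P' Q' ->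
  C1_grad D (fun z => u z * v z) (fun z => P z * v z + u z * P' z)
    (fun z => Q z * v z + u z * Q' z).
Proof.
intros D u v P Q P' Q' HD Hu Hv z Hz.
destruct (Hu z Hz) as (H1 & H2 & H3 & H4).
destruct (Hv z Hz) as (K1 & K2 & K3 & K4).
assert (Cu := grad_continuous _ _ _ _ _ HD Hu Hz).
assert (Cv := grad_continuous _ _ _ _ _ HD Hv Hz).
destruct z as [x y]; simpl fst in *; simpl snd in *.
split; [|split; [|split]].
- evar_last; [apply (is_derive_mult _ _ _ _ _ H1 K1); intros; apply Rmult_comm|]; reflexivity.
- evar_last; [apply (is_derive_mult _ _ _ _ _ H2 K2); intros; apply Rmult_comm|]; reflexivity.
- apply continuous_Rplus; apply continuous_Rmult; assumption.
- apply continuous_Rplus; apply continuous_Rmult; assumption.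
Qed.

Lemma grad_inv : forall D u P Q, open D -> (forall z, D z -> u z <> 0) ->
  C1_grad D u P Q ->
  C1_grad D (fun z => / u z) (fun z => - P z * (/ u z * / u z)) (fun z => - Q z * (/ u z * / u z)).
Proof.
intros D u P Q HD N Hu z Hz.
destruct (Hu z Hz) as (H1 & H2 & H3 & H4).
assert (Cu := grad_continuous _ _ _ _ _ HD Hu Hz).
assert (Nz := N z Hz).
assert (Ci := continuous_comp u Rinv z Cu (continuous_Rinv _ Nz)).
destruct z as [x y]; simpl fst in *; simpl snd in *.
split; [|split; [|split]].
- evar_last; [apply (is_derive_inv _ _ _ H1 Nz)|]; simpl; field; assumption.
- evar_last; [apply (is_derive_inv _ _ _ H2 Nz)|]; simpl; field; assumption.
- apply continuous_Rmult; [apply (continuous_opp (V := R_NormedModule)); assumption|].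
  apply continuous_Rmult; assumption.
- apply continuous_Rmult; [apply (continuous_opp (V := R_NormedModule)); assumption|].
  apply continuous_Rmult; assumption.
Qed.

Lemma grad_const : forall D c, C1_grad D (fun _ => c) (fun _ => 0) (fun _ => 0).
Proof.
intros D c z _.
split; [|split; [|split; apply continuous_const]]; apply (is_derive_const (V := R_NormedModule)).
Qed.

Lemma grad_of_differentiable : forall D u P Q,
  (forall z, D z -> differentiable_pt_lim (fun x y => u (x, y)) (fst z) (snd z) (P z) (Q z)) ->
  (forall z, D z -> continuous P z /\ continuous Q z) -> C1_grad D u P Q.
Proof.
intros D u P Q H HC z Hz.
split; [|split; [|apply HC; assumption]]; apply is_derive_Reals.
- replace (P z) with (P z * 1 + Q z * 0) by ring.
  apply (derivable_pt_lim_comp_2d (fun x y => u (x, y)) (fun t => t) (fun _ => snd z)).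
  + apply H; assumption.
  + apply derivable_pt_lim_id.
  + apply derivable_pt_lim_const.
- replace (Q z) with (P z * 0 + Q z * 1) by ring.
  apply (derivable_pt_lim_comp_2d (fun x y => u (x, y)) (fun _ => fst z) (fun t => t)).
  + apply H; assumption.
  + apply derivable_pt_lim_const.
  + apply derivable_pt_lim_id.
Qed.

(** * Growth at a puncture *)

(** Each half circle is the image of a compact interval under
    t |-> (t, +- sqrt (d^2 - t^2)). *)
Lemma circle_bound : forall (F : C -> R) (z0 : C) d, 0 < d ->
  (forall z : C, Cmod (z - z0)%C = d -> continuous F z) ->
  exists M, forall z : C, Cmod (z - z0)%C = d -> Rabs (F z) <= M.
Proof.
assert (half : forall (F : C -> R) (z0 : C) d s, 0 < d -> s ^ 2 = 1 ->
  (forall z : C, Cmod (z - z0)%C = d -> continuous F z) ->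
  exists M, forall t, - d <= t <= d ->
    Rabs (F (Re z0 + t, Im z0 + s * sqrt (d ^ 2 - t ^ 2))) <= M).
{ intros F z0 d s Hd Hs HF.
  destruct (continuity_ab_maj
    (fun t => Rabs (F (Re z0 + t, Im z0 + s * sqrt (d ^ 2 - t ^ 2)))) (- d) d ltac:(lra))
    as [m [Hm _]].
  - intros t Ht; apply continuity_pt_filterlim.
    apply (continuous_comp (fun t => F (Re z0 + t, Im z0 + s * sqrt (d ^ 2 - t ^ 2))) Rabs);
      [|apply continuous_Rabs].
    apply (continuous_comp (V := C_UniformSpace) (fun t : R => (Re z0 + t, Im z0 + s * sqrt (d ^ 2 - t ^ 2)) : C) F).
    + apply (continuous_comp_2 (fun t => Re z0 + t) (fun t => Im z0 + s * sqrt (d ^ 2 - t ^ 2)) (fun x y => (x, y) : C)).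
      * apply continuity_pt_filterlim; reg.
      * apply (continuous_plus (V := R_NormedModule)); [apply continuous_const|].
        apply (continuous_scal_r (K := R_AbsRing) (V := R_NormedModule)).
        apply continuous_comp; [|apply continuous_sqrt].
        apply continuity_pt_filterlim; reg.
      * apply continuous_ext with (fun z : C => z); [intros []; reflexivity | apply continuous_id].
    + apply HF; unfold Cmod.
      replace (fst _) with t by (simpl; unfold Re; ring).
      replace (snd _) with (s * sqrt (d ^ 2 - t ^ 2)) by (simpl; unfold Im; ring).
      assert (Hdt : 0 <= (d - t) * (d + t)) by (apply Rmult_le_pos; lra).
      rewrite Rpow_mult_distr, pow2_sqrt, Hs by (simpl; lra).
      replace (t ^ 2 + 1 * (d ^ 2 - t ^ 2)) with (d ^ 2) by ring.
      apply sqrt_pow2; lra.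
  - eexists; intros t Ht; apply (Hm t Ht). }
intros F z0 d Hd HF.
destruct (half F z0 d 1 Hd ltac:(ring) HF) as [M1 H1].
destruct (half F z0 d (-1) Hd ltac:(ring) HF) as [M2 H2].
exists (Rmax M1 M2); intros [x y] Hz.
assert (E : (x - Re z0) ^ 2 + (y - Im z0) ^ 2 = d ^ 2).
{ rewrite <- Hz, Cmod2_alt; reflexivity. }
assert (Hx : - d <= x - Re z0 <= d) by (assert (K := pow2_ge_0 (y - Im z0)); nra).
assert (Ey : sqrt (d ^ 2 - (x - Re z0) ^ 2) = Rabs (y - Im z0)).
{ rewrite <- E, <- sqrt_Rsqr_abs; f_equal; unfold Rsqr; ring. }
specialize (H1 _ Hx); specialize (H2 _ Hx); rewrite Ey in H1, H2.
replace (Re z0 + (x - Re z0)) with x in * by ring.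
destruct (Rle_dec 0 (y - Im z0)).
- rewrite (Rabs_pos_eq (y - Im z0)) in H1 by assumption.
  replace (Im z0 + 1 * (y - Im z0)) with y in H1 by ring.
  eapply Rle_trans, Rmax_l; assumption.
- rewrite (Rabs_left1 (y - Im z0)) in H2 by lra.
  replace (Im z0 + -1 * - (y - Im z0)) with y in H2 by ring.
  eapply Rle_trans, Rmax_r; assumption.
Qed.

Lemma locally_Cmod_lt : forall (z0 : C) d, 0 < d -> locally z0 (fun z : C => Cmod (z - z0)%C < d).
Proof.
intros z0 d Hd.
assert (Hd2 : 0 < d / 2) by lra.
exists (mkposreal _ Hd2); intros w Hw.
apply Rle_lt_trans with (1 := Cmod_2Rmax _).
assert (B : Rmax (Rabs (fst (w - z0)%C)) (Rabs (snd (w - z0)%C)) < d / 2).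
{ apply Rmax_lub_lt; apply Hw. }
assert (S2 : sqrt 2 <= 2) by (rewrite <- (sqrt_pow2 2) at 2 by lra; apply sqrt_le_1_alt; lra).
assert (S0 := sqrt_pos 2).
assert (R0 := Rle_trans _ _ _ (Rabs_pos _) (Rmax_l (Rabs (fst (w - z0)%C)) (Rabs (snd (w - z0)%C)))).
nra.
Qed.

Lemma Cmod_lt_ball : forall (z0 z : C) r, Cmod (z - z0)%C < r -> ball z0 r z.
Proof.
intros z0 z r H; assert (M := Rmax_Cmod (z - z0)%C).
split; eapply Rle_lt_trans with (2 := H); eapply Rle_trans with (2 := M);
  [apply Rmax_l | apply Rmax_r].
Qed.

(** On [r, d] one has k / t^n <= k d n / t^(n+1), which is minus the derivative of
    k d / t^n.  So both k d / t^n - phi and k d / t^n + phi decrease, and the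
    increment of phi is at most k d / r^n.  The factor d lost here is what makes
    the estimate a little-o, and the case n = 1 needs no logarithm. *)
Lemma radial_increment : forall (phi dphi : R -> R) k n r d,
  (1 <= n)%nat -> 0 <= k -> 0 < r <= d ->
  (forall t, r <= t <= d -> is_derive phi t (dphi t) /\ Rabs (dphi t) <= k * / t ^ n) ->
  r ^ n * Rabs (phi r - phi d) <= k * d.
Proof.
assert (side : forall (phi dphi : R -> R) k n r d,
  (1 <= n)%nat -> 0 <= k -> 0 < r <= d ->
  (forall t, r <= t <= d -> is_derive phi t (dphi t) /\ Rabs (dphi t) <= k * / t ^ n) ->
  r ^ n * (phi r - phi d) <= k * d).
{ intros phi dphi k n r d Hn Hk Hr H.
  set (h := fun t => k * d * / t ^ n - phi t).
  set (dh := fun t => k * d * (- (INR n * t ^ pred n) / (t ^ n) ^ 2) - dphi t).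
  assert (Hd : forall t, r <= t <= d -> is_derive h t (dh t)).
  { intros t Ht; apply (is_derive_minus (V := R_NormedModule)); [|apply H; assumption].
    apply is_derive_scal; apply is_derive_inv; [|apply pow_nonzero; lra].
    evar_last; [apply (is_derive_pow (fun t => t) n t 1 (is_derive_id t))|]; ring. }
  destruct (MVT_gen h r d dh) as [c [Hc E]].
  - rewrite Rmin_left, Rmax_right by lra; intros t Ht; apply Hd; lra.
  - rewrite Rmin_left, Rmax_right by lra; intros t Ht.
    apply continuity_pt_filterlim, (ex_derive_continuous h t); eexists; apply Hd; lra.
  - rewrite Rmin_left, Rmax_right in Hc by lra.
    destruct (H c Hc) as [_ Hb].
    assert (Hcn : 0 < c ^ n) by (apply pow_lt; lra).
    assert (Dc : dh c <= 0).
    { unfold dh.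
      replace (k * d * (- (INR n * c ^ pred n) / (c ^ n) ^ 2))
        with (- (k * / c ^ n) * (INR n * (d / c))).
      2:{ destruct n as [|n]; [lia|]; simpl pred.
          replace (c ^ S n) with (c * c ^ n) by reflexivity.
          field; split; [apply pow_nonzero|]; lra. }
      assert (N1 : 1 <= INR n) by (apply (le_INR 1); assumption).
      assert (D1 : 1 <= d / c) by (apply Rmult_le_reg_r with c; [lra|]; field_simplify; lra).
      assert (N2 : 1 <= INR n * (d / c)) by nra.
      assert (Kc : 0 <= k * / c ^ n)
        by (apply Rmult_le_pos; [|left; apply Rinv_0_lt_compat]; assumption).
      apply Rabs_le_between in Hb; nra. }
    assert (Hh : h d <= h r) by nra.
    unfold h in Hh.
    assert (Hrn : 0 < r ^ n) by (apply pow_lt; lra).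
    assert (Hdn : 0 <= k * d * / d ^ n).
    { apply Rmult_le_pos; [apply Rmult_le_pos; lra|].
      left; apply Rinv_0_lt_compat, pow_lt; lra. }
    replace (k * d) with (r ^ n * (k * d * / r ^ n)) by (field; lra).
    apply Rmult_le_compat_l; lra. }
intros phi dphi k n r d Hn Hk Hr H.
assert (S1 := side phi dphi k n r d Hn Hk Hr H).
assert (S2 := side (fun t => - phi t) (fun t => - dphi t) k n r d Hn Hk Hr).
unfold Rabs; destruct Rcase_abs; [|assumption].
replace (- (phi r - phi d)) with (- phi r - - phi d) by ring.
apply S2; intros t Ht; destruct (H t Ht) as [H1 H2]; split.
- apply (is_derive_opp (V := R_NormedModule)); assumption.
- rewrite Rabs_Ropp; assumption.
Qed.

Lemma filterlim_Cmod : forall (T : Type) (F : (T -> Prop) -> Prop) (h : T -> C) (l : C),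
  Filter F ->
  (filterlim h F (locally l) <-> forall eps, 0 < eps -> F (fun x => Cmod (h x - l)%C < eps)).
Proof.
intros T F h l HF; split; intros H.
- intros eps Heps; apply (H (fun w => Cmod (w - l)%C < eps)), locally_Cmod_lt, Heps.
- intros S [d Hd]; apply (filter_imp _ (fun x => S (h x))) with (2 := H d (cond_pos d)).
  intros x Hx; apply Hd, Cmod_lt_ball, Hx.
Qed.

Lemma locally_bounded : forall (u : C -> R) z, continuous u z ->
  exists M, 0 < M /\ locally z (fun s => Rabs (u s) <= M).
Proof.
intros u z H; exists (Rabs (u z) + 1); split; [assert (K := Rabs_pos (u z)); lra|].
assert (L := proj1 (filterlim_locally _ _) H (mkposreal 1 Rlt_0_1)).
apply filter_imp with (2 := L); intros s Hs.
assert (B : Rabs (u s - u z) < 1) by apply Hs.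
replace (u s) with (u s - u z + u z) by ring.
assert (K := Rabs_triang (u s - u z) (u z)); lra.
Qed.

(** From the circle of radius d to the point z the function changes by at most
    2 K d / r^n; for small d this is at most eps / (2 r^n), and the values on the
    circle are negligible once r is small compared with d. *)
Lemma gradient_growth : forall D F P Q (z0 : C) n K, open D -> C1_grad D F P Q ->
  (1 <= n)%nat -> 0 <= K ->
  locally' z0 (fun z => D z /\ Rabs (P z) <= K * / Cmod (z - z0)%C ^ n /\
    Rabs (Q z) <= K * / Cmod (z - z0)%C ^ n) ->
  forall eps, 0 < eps -> locally' z0 (fun z => Cmod (z - z0)%C ^ n * Rabs (F z) < eps).
Proof.
intros D F P Q z0 n K HD HF Hn HK [r0 Hr0] eps Heps.
assert (R0 := cond_pos r0).
set (d := Rmin (r0 / 2) (eps / (4 * (K + 1)))).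
assert (Hq : 0 < eps / (4 * (K + 1))) by (apply Rdiv_lt_0_compat; lra).
assert (Hd : 0 < d) by (apply Rmin_glb_lt; lra).
assert (Hd1 : d <= r0 / 2) by apply Rmin_l.
assert (Hd2 : 2 * K * d <= eps / 2).
{ apply Rle_trans with (2 * (K + 1) * (eps / (4 * (K + 1)))).
  - assert (d <= eps / (4 * (K + 1))) by apply Rmin_r; nra.
  - right; field; lra. }
assert (Hin : forall z : C, 0 < Cmod (z - z0)%C <= d -> D z /\
    Rabs (P z) <= K * / Cmod (z - z0)%C ^ n /\ Rabs (Q z) <= K * / Cmod (z - z0)%C ^ n).
{ intros z [H1 H2]; apply Hr0.
  - apply Cmod_lt_ball; lra.
  - intros ->; revert H1; replace (z0 - z0)%C with (RtoC 0) by ring; rewrite Cmod_0; lra. }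
destruct (circle_bound F z0 d Hd) as [M HM].
{ intros z Hz; apply (grad_continuous D F P Q); [assumption..|]; apply Hin; lra. }
set (m := Rmin (Rmin d 1) (eps / (2 * (Rabs M + 1)))).
assert (HM0 := Rabs_pos M).
assert (Hm : 0 < m).
{ apply Rmin_glb_lt; [apply Rmin_glb_lt; lra|]; apply Rdiv_lt_0_compat; lra. }
assert (Hm1 : m <= d) by (eapply Rle_trans; [apply Rmin_l|]; apply Rmin_l).
assert (Hm2 : m <= 1) by (eapply Rle_trans; [apply Rmin_l|]; apply Rmin_r).
assert (Hm3 : m <= eps / (2 * (Rabs M + 1))) by apply Rmin_r.
apply filter_imp with (2 := locally_Cmod_lt z0 m Hm).
intros z Hzm Hz.
set (r := Cmod (z - z0)%C) in *.
assert (Hr : 0 < r).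
{ apply Cmod_gt_0; intros E; apply Hz; now apply Ceq_minus. }
set (e1 := (Re z - Re z0) / r); set (e2 := (Im z - Im z0) / r).
assert (Er : (Re z - Re z0) ^ 2 + (Im z - Im z0) ^ 2 = r ^ 2)
  by (unfold r; rewrite Cmod2_alt; reflexivity).
assert (Ee : e1 ^ 2 + e2 ^ 2 = 1).
{ unfold e1, e2; transitivity (((Re z - Re z0) ^ 2 + (Im z - Im z0) ^ 2) / r ^ 2);
    [field; lra|]; rewrite Er; field; lra. }
assert (He1 : Rabs e1 <= 1) by (apply Rabs_le; assert (K2 := pow2_ge_0 e2); nra).
assert (He2 : Rabs e2 <= 1) by (apply Rabs_le; assert (K2 := pow2_ge_0 e1); nra).
set (pt := fun t => (Re z0 + t * e1, Im z0 + t * e2) : C).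
assert (Hpt : forall t, 0 < t -> Cmod (pt t - z0)%C = t).
{ intros t Ht; unfold Cmod.
  replace (fst (pt t - z0)%C) with (t * e1) by (simpl; unfold Re; ring).
  replace (snd (pt t - z0)%C) with (t * e2) by (simpl; unfold Im; ring).
  replace ((t * e1) ^ 2 + (t * e2) ^ 2) with (t ^ 2) by (rewrite 2!Rpow_mult_distr, <- Rmult_plus_distr_l, Ee; ring).
  apply sqrt_pow2; lra. }
assert (Ez : pt r = z).
{ unfold pt, e1, e2; destruct z as [x y]; simpl; f_equal; field; lra. }
assert (Inc := radial_increment (fun t => F (pt t)) (fun t => P (pt t) * e1 + Q (pt t) * e2)
  (2 * K) n r d Hn ltac:(lra) ltac:(lra)).
assert (Dr : r ^ n * Rabs (F z - F (pt d)) <= 2 * K * d).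
{ rewrite <- Ez; apply Inc; clear Inc; intros t Ht.
  destruct (Hin (pt t)) as (D1 & B1 & B2); [rewrite Hpt; lra|].
  rewrite Hpt in B1, B2 by lra; split.
  - apply is_derive_Reals.
    apply (derivable_pt_lim_comp_2d (fun x y => F (x, y)) (fun t => Re z0 + t * e1) (fun t => Im z0 + t * e2)).
    + apply (grad_differentiable D F P Q (pt t)); assumption.
    + apply is_derive_Reals; auto_derive; [trivial | ring].
    + apply is_derive_Reals; auto_derive; [trivial | ring].
  - eapply Rle_trans; [apply Rabs_triang|]; rewrite !Rabs_mult.
    assert (A1 := Rabs_pos (P (pt t))); assert (A2 := Rabs_pos (Q (pt t))).
    assert (A3 := Rabs_pos e1); assert (A4 := Rabs_pos e2).
    nra. }
assert (Md : Rabs (F (pt d)) <= Rabs M).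
{ eapply Rle_trans, Rle_abs; apply HM, Hpt, Hd. }
assert (rn : 0 < r ^ n <= r).
{ split; [apply pow_lt, Hr|].
  destruct n as [|n]; [lia|]; simpl.
  assert (K1 : r ^ n <= 1) by (rewrite <- (pow1 n); apply pow_incr; lra).
  nra. }
assert (Mm : r * (Rabs M + 1) < eps / 2).
{ apply Rlt_le_trans with (eps / (2 * (Rabs M + 1)) * (Rabs M + 1)).
  - apply Rmult_lt_compat_r; lra.
  - right; field; lra. }
assert (T : Rabs (F z) <= Rabs (F z - F (pt d)) + Rabs (F (pt d))).
{ replace (F z) with (F z - F (pt d) + F (pt d)) at 1 by ring; apply Rabs_triang. }
assert (T1 : r ^ n * Rabs (F z) <= r ^ n * (Rabs (F z - F (pt d)) + Rabs (F (pt d))))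
  by (apply Rmult_le_compat_l; lra).
assert (T2 : r ^ n * Rabs (F (pt d)) <= r * Rabs M)
  by (apply Rmult_le_compat; auto using Rabs_pos; lra).
lra.
Qed.

(** * The Vekua equation and the transplant *)

Lemma dzbar_eq : forall W z, dzbar W z =
  ((Dx (fun s => Re (W s)) z - Dy (fun s => Im (W s)) z) / 2,
   (Dx (fun s => Im (W s)) z + Dy (fun s => Re (W s)) z) / 2).
Proof.
intros W z; unfold dzbar; rewrite <- RtoC_inv by lra.
apply injective_projections; simpl; field.
Qed.

Lemma dzbar_real : forall u z, dzbar (fun s => RtoC (u s)) z = (Dx u z / 2, Dy u z / 2).
Proof.
intros u z; rewrite dzbar_eq; simpl.
change (Dx (fun _ => 0) z) with (Derive (fun _ => 0) (fst z)).
change (Dy (fun _ => 0) z) with (Derive (fun _ => 0) (snd z)).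
rewrite !Derive_const; f_equal; unfold Dx, Dy; field.
Qed.

Lemma vekua_real_form : forall f W z, f z <> 0 ->
  dzbar W z = (dzbar (fun s => RtoC (f s)) z / f z * Cconj (W z))%C <->
  Dx (fun s => Re (W s)) z - Dy (fun s => Im (W s)) z
    = (Dx f z * Re (W z) + Dy f z * Im (W z)) / f z /\
  Dx (fun s => Im (W s)) z + Dy (fun s => Re (W s)) z
    = (Dy f z * Re (W z) - Dx f z * Im (W z)) / f z.
Proof.
intros f W z Hf; rewrite dzbar_real, dzbar_eq; unfold Cdiv; rewrite <- RtoC_inv by assumption.
set (X := Dx _ z - _); set (Y := Dx _ z + _).
transitivity (X / 2 = Dx f z / 2 * / f z * Re (W z) + Dy f z / 2 * / f z * Im (W z) /\
  Y / 2 = Dy f z / 2 * / f z * Re (W z) - Dx f z / 2 * / f z * Im (W z)).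
- split.
  + intros E; assert (E1 := f_equal Re E); assert (E2 := f_equal Im E).
    simpl in E1, E2; unfold Re, Im in *; split; [rewrite E1 | rewrite E2]; ring.
  + intros [E1 E2]; apply injective_projections; simpl; [rewrite E1 | rewrite E2];
      unfold Re, Im; ring.
- split; intros [E1 E2]; split.
  + replace X with (2 * (X / 2)) by field; rewrite E1; field; assumption.
  + replace Y with (2 * (Y / 2)) by field; rewrite E2; field; assumption.
  + rewrite E1; field; assumption.
  + rewrite E2; field; assumption.
Qed.

Lemma Pplus_eq : forall W z, Pplus W z = RtoC (Re (W z)).
Proof.
intros W z; unfold Pplus; rewrite <- RtoC_inv by lra.
apply injective_projections; simpl; unfold Re; field.
Qed.

(** The integrand of the transplant is i g^2 d_zbar (U / g), and d_zbar of a real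
    function is half its gradient. *)
Lemma Phi_eq : forall D g W z, open D -> (forall z, D z -> g z <> 0) ->
  C1_on D g -> C1_on D (fun s => Re (W s)) -> D z ->
  (Ci * g z ^ 2 * dzbar (fun s => / g s * Pplus W s) z)%C =
  ((Dy g z * Re (W z) - g z * Dy (fun s => Re (W s)) z) / 2,
   (g z * Dx (fun s => Re (W s)) z - Dx g z * Re (W z)) / 2).
Proof.
intros D g W z HD Ng Hg HW Hz.
assert (E : forall s, D s -> (/ g s * Pplus W s)%C = RtoC (/ g s * Re (W s))).
{ intros s Hs; rewrite Pplus_eq, RtoC_mult, RtoC_inv by (apply Ng, Hs); reflexivity. }
assert (Gq := grad_mult _ _ _ _ _ _ _ HD (grad_inv _ _ _ _ HD Ng (C1_on_grad _ _ Hg)) (C1_on_grad _ _ HW)).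
assert (GR := grad_ext D _ (fun s => Re (/ g s * Pplus W s)%C) _ _ _ _ HD
  (fun s Hs => conj (eq_sym (f_equal Re (E s Hs))) (conj eq_refl eq_refl)) Gq).
assert (GI := grad_ext D _ (fun s => Im (/ g s * Pplus W s)%C) _ _ _ _ HD
  (fun s Hs => conj (eq_sym (f_equal Im (E s Hs))) (conj eq_refl eq_refl)) (grad_const D 0)).
rewrite dzbar_eq.
destruct (grad_unique _ _ _ _ _ GR Hz) as [-> ->].
destruct (grad_unique _ _ _ _ _ GI Hz) as [-> ->].
rewrite <- RtoC_pow.
assert (Nz := Ng z Hz).
apply injective_projections; simpl; field; assumption.
Qed.

Lemma Abar_grad : forall Om z0 z1 g W A, open Om -> connected_set Om ->
  C1_on Om g -> (forall z, Om z -> g z <> 0) -> punctured Om z0 z1 ->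
  C1_on (punctured Om z0) (fun s => Re (W s)) ->
  is_Abar Om z0 z1
      (fun z => Ci * (g z) ^ 2 * dzbar (fun s => / g s * Pplus W s) z)%C A ->
  C1_grad (punctured Om z0) A
    (fun z => Dy g z * Re (W z) - g z * Dy (fun s => Re (W s)) z)
    (fun z => g z * Dx (fun s => Re (W s)) z - Dx g z * Re (W z)).
Proof.
intros Om z0 z1 g W A HO HC Hg Ng Hz1 HW HA.
assert (HD := open_punctured Om z0 HO).
assert (HgD : C1_on (punctured Om z0) g) by (intros z Hz; apply Hg, Hz).
assert (NgD : forall z, punctured Om z0 z -> g z <> 0) by (intros z Hz; apply Ng, Hz).
assert (HPhi := fun z => Phi_eq (punctured Om z0) g W z HD NgD HgD HW).
assert (Cont : forall z, punctured Om z0 z ->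
  continuous (fun z => Dy g z * Re (W z) - g z * Dy (fun s => Re (W s)) z) z /\
  continuous (fun z => g z * Dx (fun s => Re (W s)) z - Dx g z * Re (W z)) z).
{ intros z Hz.
  assert (C1 := grad_continuous _ _ _ _ _ HD (C1_on_grad _ _ HgD) Hz).
  assert (C2 := grad_continuous _ _ _ _ _ HD (C1_on_grad _ _ HW) Hz).
  destruct (HgD z Hz) as (_ & _ & C3 & C4).
  destruct (HW z Hz) as (_ & _ & C5 & C6).
  split; apply continuous_Rminus; apply continuous_Rmult; assumption. }
apply grad_of_differentiable; [|exact Cont].
intros z Hz.
destruct (punctured_reachable Om z0 z1 z HO HC Hz1 Hz) as [gam Hgam].
destruct (Cont z Hz) as [CP CQ].
replace (Dy g z * _ - _) with (2 * Re (Ci * (g z) ^ 2 * dzbar (fun s => / g s * Pplus W s) z)%C)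
  by (rewrite HPhi by assumption; simpl; field).
replace (g z * _ - _) with (2 * Im (Ci * (g z) ^ 2 * dzbar (fun s => / g s * Pplus W s) z)%C)
  by (rewrite HPhi by assumption; simpl; field).
apply (Abar_differentiable Om z0 z1 _ A z gam HD HA Hgam Hz).
- apply continuous_ext_loc with (fun z => / 2 * (Dy g z * Re (W z) - g z * Dy (fun s => Re (W s)) z)).
  + apply filter_imp with (2 := HD z Hz); intros s Hs; rewrite HPhi by assumption; simpl; field.
  + apply continuous_Rmult; [apply continuous_const | assumption].
- apply continuous_ext_loc with (fun z => / 2 * (g z * Dx (fun s => Re (W s)) z - Dx g z * Re (W z))).
  + apply filter_imp with (2 := HD z Hz); intros s Hs; rewrite HPhi by assumption; simpl; field.
  + apply continuous_Rmult; [apply continuous_const | assumption].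
Qed.

(** The two components of grad A are, after division by g, the two real equations
    of the Vekua equation of g for U + i A / g. *)
Lemma transplant_vekua : forall D g W w A, open D ->
  C1_on D g -> (forall z, D z -> g z <> 0) -> C1_on D (fun s => Re (W s)) ->
  C1_grad D A
    (fun z => Dy g z * Re (W z) - g z * Dy (fun s => Re (W s)) z)
    (fun z => g z * Dx (fun s => Re (W s)) z - Dx g z * Re (W z)) ->
  (forall z, D z -> w z = (Re (W z), A z * / g z)) ->
  vekua_solution D g w.
Proof.
intros D g W w A HD Hg Ng HU GA Ew.
assert (GR : C1_grad D (fun s => Re (w s)) (Dx (fun s => Re (W s))) (Dy (fun s => Re (W s)))).
{ apply grad_ext with (3 := C1_on_grad _ _ HU); [assumption|].
  intros z Hz; rewrite Ew by assumption; auto. }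
assert (GQ := grad_mult _ _ _ _ _ _ _ HD GA (grad_inv _ _ _ _ HD Ng (C1_on_grad _ _ Hg))).
assert (GI := grad_ext D _ (fun s => Im (w s)) _ _ _ _ HD
  (fun s Hs => conj (eq_sym (f_equal Im (Ew s Hs))) (conj eq_refl eq_refl)) GQ).
split; [split|].
- apply grad_C1_on with (2 := GR); assumption.
- apply grad_C1_on with (2 := GI); assumption.
- intros z Hz; apply vekua_real_form; [apply Ng; assumption|].
  destruct (grad_unique _ _ _ _ _ GR Hz) as [-> ->].
  destruct (grad_unique _ _ _ _ _ GI Hz) as [-> ->].
  rewrite Ew by assumption; simpl.
  assert (Nz := Ng z Hz); split; field; assumption.
Qed.

(** Both A and g V have a gradient that contains derivatives of U and V; the
    Vekua equation of f says that these cancel in the difference. *)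
Lemma conjugate_difference_grad : forall D f g W A, open D ->
  (forall z, D z -> f z <> 0) -> C1_on D g -> vekua_solution D f W ->
  C1_grad D A
    (fun z => Dy g z * Re (W z) - g z * Dy (fun s => Re (W s)) z)
    (fun z => g z * Dx (fun s => Re (W s)) z - Dx g z * Re (W z)) ->
  let alpha z := Dx g z - g z * (Dx f z * / f z) in
  let beta z := Dy g z - g z * (Dy f z * / f z) in
  C1_grad D (fun z => A z - g z * Im (W z))
    (fun z => beta z * Re (W z) - alpha z * Im (W z))
    (fun z => - (alpha z * Re (W z)) - beta z * Im (W z)).
Proof.
intros D f g W A HD Nf Hg [[_ HV] Hvek] GA alpha beta.
apply grad_ext with (3 := grad_minus _ _ _ _ _ _ _ GA
  (grad_mult _ _ _ _ _ _ _ HD (C1_on_grad _ _ Hg) (C1_on_grad _ _ HV))); [assumption|].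
intros z Hz; split; [reflexivity|].
destruct (proj1 (vekua_real_form f W z (Nf z Hz)) (Hvek z Hz)) as [E1 E2].
unfold alpha, beta; split.
- replace (Dy (fun s => Re (W s)) z) with
    ((Dy f z * Re (W z) - Dx f z * Im (W z)) / f z - Dx (fun s => Im (W s)) z) by lra.
  field; apply Nf, Hz.
- replace (Dx (fun s => Re (W s)) z) with
    ((Dx f z * Re (W z) + Dy f z * Im (W z)) / f z + Dy (fun s => Im (W s)) z) by lra.
  field; apply Nf, Hz.
Qed.

(** * Comparison with the model power *)

Lemma Cmod_div_model : forall (a z0 z w : C) n, a <> 0 -> z <> z0 ->
  Cmod (w / (a * / (z - z0) ^ n))%C = Cmod w * Cmod (z - z0)%C ^ n / Cmod a.
Proof.
intros a z0 z w n Ha Hz.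
assert (Hz' : (z - z0)%C <> 0) by (intros E; apply Hz, Ceq_minus, E).
assert (Hp := Cpow_nz _ n Hz').
replace (w / (a * / (z - z0) ^ n))%C with (w * (z - z0) ^ n / a)%C by (field; auto).
rewrite Cmod_div, Cmod_mult, Cmod_pow by assumption; reflexivity.
Qed.

Lemma locally'_neq : forall (z0 : C), locally' z0 (fun z => z <> z0).
Proof. intros z0; exists (mkposreal 1 Rlt_0_1); auto. Qed.

Lemma locally_locally' : forall (z0 : C) (S : C -> Prop), locally z0 S -> locally' z0 S.
Proof. intros z0 S HS; apply filter_imp with (2 := HS); auto. Qed.

Lemma model_growth : forall (Z : C -> C) (a z0 : C) n, a <> 0 ->
  filterlim (fun z => Z z / (a * / (z - z0) ^ n))%C (locally' z0) (locally (RtoC 1)) ->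
  locally' z0 (fun z => Cmod (Z z) <= 2 * Cmod a * / Cmod (z - z0)%C ^ n).
Proof.
intros Z a z0 n Ha Hlim.
assert (Ha0 := proj1 (Cmod_gt_0 a) Ha).
rewrite filterlim_Cmod in Hlim by typeclasses eauto.
generalize (filter_and _ _ (Hlim 1 Rlt_0_1) (locally'_neq z0)).
apply filter_imp; intros z [B Hz].
assert (T := Cmod_triangle (Z z / (a * / (z - z0) ^ n) - 1) 1).
replace (Z z / (a * / (z - z0) ^ n) - 1 + 1)%C
  with (Z z / (a * / (z - z0) ^ n))%C in T by ring.
rewrite Cmod_1, Cmod_div_model in T by assumption.
assert (Hz' : 0 < Cmod (z - z0)%C ^ n).
{ apply pow_lt, Cmod_gt_0; intros E; apply Hz, Ceq_minus, E. }
apply Rmult_le_reg_r with (Cmod (z - z0)%C ^ n / Cmod a).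
- apply Rdiv_lt_0_compat; assumption.
- field_simplify; [|lra|lra]; unfold Rdiv in T; lra.
Qed.

Lemma model_perturbation : forall (Z Z' : C -> C) (a z0 : C) n, a <> 0 ->
  filterlim (fun z => Z z / (a * / (z - z0) ^ n))%C (locally' z0) (locally (RtoC 1)) ->
  (forall eps, 0 < eps ->
     locally' z0 (fun z => Cmod (z - z0)%C ^ n * Cmod (Z' z - Z z)%C < eps)) ->
  filterlim (fun z => Z' z / (a * / (z - z0) ^ n))%C (locally' z0) (locally (RtoC 1)).
Proof.
intros Z Z' a z0 n Ha Hlim Hw.
assert (Ha0 := proj1 (Cmod_gt_0 a) Ha).
rewrite filterlim_Cmod in Hlim |- * by typeclasses eauto.
intros eps Heps.
assert (Heps2 : 0 < eps / 2) by lra.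
assert (Heps3 : 0 < eps / 2 * Cmod a) by (apply Rmult_lt_0_compat; assumption).
generalize (filter_and _ _ (locally'_neq z0) (filter_and _ _ (Hlim _ Heps2) (Hw _ Heps3))).
apply filter_imp; intros z (Hz & B1 & B2).
replace (Z' z / (a * / (z - z0) ^ n) - 1)%C with
  ((Z z / (a * / (z - z0) ^ n) - 1) + (Z' z - Z z) / (a * / (z - z0) ^ n))%C
  by (unfold Cdiv; ring).
eapply Rle_lt_trans; [apply Cmod_triangle|].
rewrite Cmod_div_model by assumption.
assert (Small : Cmod (Z' z - Z z) * Cmod (z - z0) ^ n / Cmod a <= eps / 2).
{ apply Rmult_le_reg_r with (Cmod a); [assumption|].
  field_simplify; lra. }
lra.
Qed.

(** Near z0 the gradient of A - g V is bounded by a constant times |W|, that is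
    by a constant times |z - z0|^(-n). *)
Lemma conjugate_difference_growth : forall Om f g A W (a z0 : C) n, open Om ->
  C1_on Om f -> (forall z, Om z -> f z <> 0) -> C1_on Om g -> Om z0 ->
  a <> 0 -> (1 <= n)%nat -> formal_power_neg Om f n a z0 W ->
  C1_grad (punctured Om z0) A
    (fun z => Dy g z * Re (W z) - g z * Dy (fun s => Re (W s)) z)
    (fun z => g z * Dx (fun s => Re (W s)) z - Dx g z * Re (W z)) ->
  forall eps, 0 < eps ->
  locally' z0 (fun z => Cmod (z - z0)%C ^ n * Rabs (A z - g z * Im (W z)) < eps).
Proof.
intros Om f g A W a z0 n HO Hf Nf Hg Hz0 Ha Hn [Hvek Hlim] GA.
assert (HD := open_punctured Om z0 HO).
assert (GF := conjugate_difference_grad (punctured Om z0) f g W A HD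
  (fun z Hz => Nf z (proj1 Hz)) (fun z Hz => Hg z (proj1 Hz)) Hvek GA).
cbv zeta in GF.
set (alpha := fun z => Dx g z - g z * (Dx f z * / f z)).
set (beta := fun z => Dy g z - g z * (Dy f z * / f z)).
destruct (Hf z0 Hz0) as (_ & _ & Cfx & Cfy).
destruct (Hg z0 Hz0) as (_ & _ & Cgx & Cgy).
assert (Cf := grad_continuous _ _ _ _ _ HO (C1_on_grad _ _ Hf) Hz0).
assert (Cg := grad_continuous _ _ _ _ _ HO (C1_on_grad _ _ Hg) Hz0).
assert (Cif := continuous_comp f Rinv z0 Cf (continuous_Rinv _ (Nf z0 Hz0))).
assert (Ca : continuous alpha z0).
{ apply continuous_Rminus; [assumption|]; apply continuous_Rmult; [assumption|].
  apply continuous_Rmult; assumption. }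
assert (Cb : continuous beta z0).
{ apply continuous_Rminus; [assumption|]; apply continuous_Rmult; [assumption|].
  apply continuous_Rmult; assumption. }
destruct (locally_bounded _ _ Ca) as (Ma & Ma0 & HMa).
destruct (locally_bounded _ _ Cb) as (Mb & Mb0 & HMb).
assert (Ha0 := proj1 (Cmod_gt_0 a) Ha).
apply (gradient_growth _ _ _ _ z0 n ((Ma + Mb) * (2 * Cmod a)) HD GF Hn); [nra|].
generalize (filter_and _ _ (locally_locally' _ _ (HO z0 Hz0))
  (filter_and _ _ (locally'_neq z0)
  (filter_and _ _ (model_growth _ _ _ _ Ha Hlim)
  (filter_and _ _ (locally_locally' _ _ HMa) (locally_locally' _ _ HMb))))).
apply filter_imp; intros z (HOz & Hz & BW & B1 & B2).
split; [split; assumption|].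
fold (alpha z) (beta z).
assert (R1 := re_le_Cmod (W z)).
assert (R2 : Rabs (Im (W z)) <= Cmod (W z))
  by (eapply Rle_trans, Rmax_Cmod; apply Rmax_r).
assert (BM := Rmult_le_compat_l (Ma + Mb) _ _ ltac:(lra) BW).
rewrite <- Rmult_assoc in BM.
assert (X1 := Rmult_le_compat _ _ _ _ (Rabs_pos _) (Rabs_pos _) B1 R1).
assert (X2 := Rmult_le_compat _ _ _ _ (Rabs_pos _) (Rabs_pos _) B1 R2).
assert (X3 := Rmult_le_compat _ _ _ _ (Rabs_pos _) (Rabs_pos _) B2 R1).
assert (X4 := Rmult_le_compat _ _ _ _ (Rabs_pos _) (Rabs_pos _) B2 R2).
split; (eapply Rle_trans; [apply Rabs_triang|]); rewrite !Rabs_Ropp, !Rabs_mult; lra.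
Qed.

Theorem theorem14 :
  forall (Om : C -> Prop) (q f g : C -> R) (z0 z1 a : C) (n : nat) (Zf Zg : C -> C),
    simply_connected_domain Om ->
    C2_on Om f -> (forall z, Om z -> f z <> 0%R) -> schroedinger_solution Om q f ->
    C2_on Om g -> (forall z, Om z -> g z <> 0%R) -> schroedinger_solution Om q g ->
    Om z0 -> punctured Om z0 z1 ->
    a <> RtoC 0 -> (1 <= n)%nat ->
    formal_power_neg Om f n a z0 Zf ->
    is_transplant Om z0 z1 g Zf Zg ->
    formal_power_neg Om g n a z0 Zg.
Proof.
intros Om q f g z0 z1 a n Zf Zg (HO & _ & HC & _) [Hf _] Nf _ [Hg _] Ng _ Hz0 Hz1 Ha Hn
  HZf (A & HA & HZg).
assert (HU := proj1 (proj1 (proj1 HZf))).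
assert (GA := Abar_grad Om z0 z1 g Zf A HO HC Hg Ng Hz1 HU HA).
assert (EZ : forall z, punctured Om z0 z -> Zg z = (Re (Zf z), A z * / g z)).
{ intros z Hz; rewrite HZg by assumption; rewrite Pplus_eq, <- RtoC_inv by (apply Ng, Hz).
  apply injective_projections; simpl; ring. }
split.
- apply (transplant_vekua _ g Zf Zg A (open_punctured Om z0 HO)); try assumption.
  + intros z Hz; apply Hg, Hz.
  + intros z Hz; apply Ng, Hz.
- apply (model_perturbation Zf Zg a z0 n Ha (proj2 HZf)); intros eps Heps.
  assert (Cg := grad_continuous _ _ _ _ _ HO (C1_on_grad _ _ Hg) Hz0).
  destruct (locally_bounded _ _ (continuous_comp g Rinv z0 Cg (continuous_Rinv _ (Ng z0 Hz0))))
    as (G & G0 & HG).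
  assert (Heps' : 0 < eps / G) by (apply Rdiv_lt_0_compat; assumption).
  generalize (filter_and _ _ (filter_and _ _ (locally_locally' _ _ (HO z0 Hz0)) (locally'_neq z0))
    (filter_and _ _ (locally_locally' _ _ HG)
      (conjugate_difference_growth Om f g A Zf a z0 n HO Hf Nf Hg Hz0 Ha Hn HZf GA _ Heps'))).
  apply filter_imp; intros z (Hz & BG & BF).
  replace (Zg z - Zf z)%C with (Ci * RtoC ((A z - g z * Im (Zf z)) * / g z))%C.
  2:{ rewrite EZ by assumption.
      apply injective_projections; simpl; unfold Re, Im; [ring|].
      field; apply Ng, Hz. }
  rewrite Cmod_mult, Cmod_Ci, Cmod_R, Rabs_mult, Rmult_1_l, <- Rmult_assoc.
  apply Rle_lt_trans with (Cmod (z - z0) ^ n * Rabs (A z - g z * Im (Zf z)) * G).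
  + apply Rmult_le_compat_l; [|assumption].
    apply Rmult_le_pos; [apply pow_le, Cmod_ge_0 | apply Rabs_pos].
  + replace eps with (eps / G * G) by (field; lra).
    apply Rmult_lt_compat_r; assumption.
Qed.
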